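(* Let $a>0$, $\nu>0$, and let $\{b_j\}_{j\ge1}$ be non-negative numbers with $0<B:=\sum_{j\ge1}b_j^2<\infty$. For any $u_0\in H$, let $u$ be the solution of the stochastic Navier--Stokes equation described in the context with $u(0)=u_0$, and set $$\xi_t=\frac1t\int_0^t\|\nabla u(s)\|^2\,ds,\qquad t>0.$$ Then there is a set of full measure $\Omega_*\subset\Omega$ such that, for any $\omega\in\Omega_*$, we have $\xi_t>0$ for all $t>0$. In particular, with probability $1$, the estimator $\hat\nu_t=\frac{B}{2\xi_t}$ is well defined for all $t>0$.
   Context: Domain and spaces: for $a>0$, $\mathbb{T}_a=\mathbb{R}/(a\mathbb{Z})$ and $D=\mathbb{T}_a\times(-1,1)$, with points $x=(x_1,x_2)$; functions on $D$ are $a$-periodic in $x_1$. $\|\cdot\|$ denotes the $L^2(D)$ norm. $H$ is the space of $u=(u_1,u_2)\in L^2(D,\mathbb{R}^2)$ with $\mathrm{div}\,u=0$ in $D$ and $u_2=0$ on $\partial D=\{x_2=\pm1\}$; $V=H\cap H_0^1(D)$; $\Pi:L^2(D,\mathbb{R}^2)\to H$ is the orthogonal projection. The Stokes operator $L=-\Pi\Delta$, with domain $V\cap H^2(D)$, is positive self-adjoint in $H$ with discrete spectrum; $\{e_j\}_{j\ge1}$ is an orthonormal basis of $H$ consisting of its eigenfunctions, with eigenvalues $\alpha_j$ indexed in increasing order. $\nabla u$ is the $2\times2$ matrix $(\partial_iu_j)$. Equation: the 2D Navier--Stokes system $\partial_tu+\langle u,\nabla\rangle u-\nu\Delta u+\nabla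 p=\eta(t,x)$, $\mathrm{div}\,u=0$, with $u=0$ at $x_2=\pm1$ and $a$-periodicity in $x_1$, is written, after applying $\Pi$, as $$\partial_tu+\nu Lu+Q(u)=\eta(t),\qquad Q(u)=\Pi\bigl((u_1\partial_1+u_2\partial_2)u\bigr),$$ with $\eta=\partial_t\zeta$, $\zeta(t,x)=\sum_{j\ge1}b_j\beta_j(t)e_j(x)$, where $\{\beta_j\}$ are independent standard Brownian motions on a probability space with sample space $\Omega$. For any $u_0\in H$ there is a unique solution with $u(0)=u_0$ whose almost every trajectory belongs to $L^2_{\mathrm{loc}}(\mathbb{R}_+,V)\cap C(\mathbb{R}_+,H)$. *)

(* Defs.v *)
From HB Require Import structures.
From mathcomp Require Import all_boot all_order all_algebra.
From mathcomp Require Import all_classical all_reals all_analysis.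

Set Implicit Arguments.
Unset Strict Implicit.
Unset Printing Implicit Defensive.
Import Order.TTheory GRing.Theory Num.Theory.
Import numFieldNormedType.Exports.

Local Open Scope classical_set_scope.
Local Open Scope ring_scope.

(* A function on D = T_a x (-1,1) is encoded as a function on R * R that is
   a-periodic in x.1; its values outside the strip -1 < x.2 < 1 are irrelevant.
   [cell a] is a fundamental domain, so integrals over D are integrals over it. *)
Notation scalar_field R := ((R * R)%type -> R) (only parsing).
Notation vector_field R := ('I_2 -> (R * R)%type -> R) (only parsing).

Section Strip.
Context {R : realType}.
Variable a : R.

Definition cell : set (R * R)%type := `[0, a[ `*` `]-1, 1[.

Lemma measurable_cell : measurable cell.
Proof. by apply: measurableX; exact: measurable_itv. Qed.

Definition area : {measure set (measurableTypeR R * measurableTypeR R)%type -> \bar R} :=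
  mrestr (lebesgue_measure \x lebesgue_measure)%E measurable_cell.

Definition periodic1 (f : scalar_field R) := forall x, f (x.1 + a, x.2) = f x.

Definition L2 (f : scalar_field R) := periodic1 f /\ f \in Lfun area 2%:E.

Definition dot (f g : scalar_field R) : R := \int[area]_x (f x * g x).

Definition dotv (u v : vector_field R) : R := \sum_(j < 2) dot (u j) (v j).

Definition normv (u : vector_field R) : R := Num.sqrt (dotv u u).

Definition basis_vec (i : 'I_2) : (R * R)%type :=
  if i == ord0 then (1, 0) else (0, 1).

Definition pderiv (i : 'I_2) (f : scalar_field R) : scalar_field R :=
  fun x => 'D_(basis_vec i) f x.

(* C^oo: every iterated partial derivative is differentiable everywhere. *)
Definition smooth (f : scalar_field R) :=
  forall (w : seq 'I_2) (x : R * R), differentiable (foldr pderiv f w) x.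

(* Restrictions to D of these functions are C^oo up to the boundary of D. *)
Definition smooth_per (f : scalar_field R) := smooth f /\ periodic1 f.

(* C_c^oo(D). *)
Definition test_fun (f : scalar_field R) :=
  smooth_per f /\
  exists2 r : R, r < 1 & forall x : R * R, r <= `|x.2| -> f x = 0.

Definition is_wderiv (i : 'I_2) (f g : scalar_field R) :=
  L2 g /\ forall phi, test_fun phi -> dot f (pderiv i phi) = - dot g phi.

(* Unique up to a.e. equality when it exists, and 0 by convention otherwise. *)
Definition wderiv (i : 'I_2) (f : scalar_field R) : scalar_field R :=
  xget (cst 0) [set g | is_wderiv i f g].

Definition H1 (f : scalar_field R) := L2 f /\ forall i, exists g, is_wderiv i f g.

Definition H2 (f : scalar_field R) := H1 f /\ forall i, H1 (wderiv i f).

(* H_0^1(D) is the closure of C_c^oo(D) in H^1(D). *)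
Definition H10 (f : scalar_field R) := H1 f /\
  exists phi : nat -> scalar_field R,
    [/\ forall n, test_fun (phi n),
        (fun n => dot (f - phi n) (f - phi n)) @ \oo --> (0 : R) &
        forall i, (fun n => dot (wderiv i f - pderiv i (phi n))
                                (wderiv i f - pderiv i (phi n)))
                  @ \oo --> (0 : R)].

Definition dot_grad (u : vector_field R) (phi : scalar_field R) : R :=
  \sum_(i < 2) dot (u i) (pderiv i phi).

Definition div_free (u : vector_field R) :=
  forall phi, test_fun phi -> dot_grad u phi = 0.

(* For div u = 0, Green's formula defines the normal trace of u as the functional
   phi |-> dot_grad u phi on functions smooth up to the boundary, and the outer
   normal on x_2 = +-1 is +-e_2; this says that u_2 = 0 on the boundary. *)
Definition normal_trace0 (u : vector_field R) :=
  forall phi, smooth_per phi -> dot_grad u phi = 0.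

Definition spaceH (u : vector_field R) :=
  [/\ forall j, L2 (u j), div_free u & normal_trace0 u].

Definition spaceV (u : vector_field R) := spaceH u /\ forall j, H10 (u j).

Definition grad (u : vector_field R) (i j : 'I_2) : scalar_field R := wderiv i (u j).

Definition dot_gradv (u v : vector_field R) : R :=
  \sum_(i < 2) \sum_(j < 2) dot (grad u i j) (grad v i j).

Definition sqnorm_grad (u : vector_field R) : R := dot_gradv u u.

Definition normV (u : vector_field R) : R := Num.sqrt (dotv u u + sqnorm_grad u).

(* [g] represents Pi f. *)
Definition is_leray (f g : vector_field R) :=
  spaceH g /\ forall h, spaceH h -> dotv (f - g) h = 0.

Definition laplacian (u : vector_field R) : vector_field R :=
  fun j => \sum_(i < 2) wderiv i (wderiv i (u j)).

Definition stokes_dom (u : vector_field R) := spaceV u /\ forall j, H2 (u j).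

(* [f] represents L u, where L = - Pi Laplacian. *)
Definition is_stokes (u f : vector_field R) :=
  stokes_dom u /\ is_leray (- laplacian u) f.

(* Indices start at 0: [e j] is the eigenfunction e_(j+1). *)
Definition stokes_eigenbasis (e : nat -> vector_field R) (alpha : nat -> R) :=
  [/\ forall j, is_stokes (e j) (alpha j *: e j),
      {homo alpha : i j / (i <= j)%N >-> i <= j},
      forall i j, dotv (e i) (e j) = (i == j)%:R &
      forall h, spaceH h ->
        (fun n => normv (h - \sum_(0 <= j < n) dotv h (e j) *: e j))
          @ \oo --> (0 : R)].

Definition advection (u : vector_field R) : vector_field R :=
  fun j => \sum_(i < 2) u i * grad u i j.

(* Extensions of L and Q to V with values in the dual of V: the projection Pi
   disappears when paired with phi in V, as V is contained in H. *)
Definition stokes_pairing (u phi : vector_field R) : R := dot_gradv u phi.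
Definition Q_pairing (u phi : vector_field R) : R := dotv (advection u) phi.

Definition C_H (u : R -> vector_field R) :=
  (forall t, 0 <= t -> spaceH (u t)) /\
  forall t, 0 <= t ->
    normv (u s - u t) @[s --> within [set s : R | 0 <= s] (nbhs t)] --> (0 : R).

(* V being separable, strong measurability of t |-> u t in V is measurability of
   the preimages of the balls of V. *)
Definition L2loc_V (u : R -> vector_field R) :=
  [/\ {ae lebesgue_measure, forall t : R, 0 <= t -> spaceV (u t)},
      forall v r, spaceV v ->
        measurable [set t : R | [/\ 0 <= t, spaceV (u t) & normV (u t - v) < r]] &
      forall T : R,
        (\int[lebesgue_measure]_(t in `[0%R, T]) ((normV (u t)) ^+ 2)%:E < +oo)%E].

End Strip.

Section Stochastic.
Context {R : realType} (a : R).
Context {d : measure_display} {Omega : measurableType d} (P : probability Omega R).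

Definition sigma_process (I : set R) (W : R -> {RV P >-> R}) : set (set Omega) :=
  <<s \bigcup_(s in I) preimage_set_system setT (W s) measurable >>.

Definition brownian (W : R -> {RV P >-> R}) :=
  [/\ {ae P, forall w, W 0 w = 0},
      forall s t : R, 0 <= s -> s < t -> forall A, measurable A ->
        P ((W t \- W s)%R @^-1` A) = normal_prob 0 (Num.sqrt (t - s)) A,
      forall s t : R, 0 <= s -> s < t ->
        forall (A : set R) (E : set Omega), measurable A ->
        sigma_process `[0, s] W E ->
        P (((W t \- W s)%R @^-1` A) `&` E) =
          (P ((W t \- W s)%R @^-1` A) * P E)%E &
      {ae P, forall w, {within `[0, +oo[, continuous (fun t => W t w)}}].

Definition independent_processes (W : nat -> R -> {RV P >-> R}) :=
  forall (js : seq nat) (E : nat -> set Omega), uniq js ->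
    (forall j, j \in js -> sigma_process `[0, +oo[ (W j) (E j)) ->
    P (\big[setI/setT]_(j <- js) E j) = (\prod_(j <- js) P (E j))%E.

(* H being separable, measurability of an H-valued map is measurability of the
   preimages of the balls of H. *)
Definition H_process (u : R -> Omega -> vector_field R) :=
  forall t, 0 <= t ->
    (forall w, spaceH a (u t w)) /\
    forall h r, spaceH a h -> measurable [set w | normv a (u t w - h) < r].

(* zeta t = sum_j b_j beta_j(t) e_j, the series converging in H. *)
Definition is_noise (b : nat -> R) (beta : nat -> R -> {RV P >-> R})
    (e : nat -> vector_field R) (zeta : R -> Omega -> vector_field R) :=
  H_process zeta /\
  {ae P, forall w, forall t, 0 <= t ->
    (fun n => normv a (zeta t w - \sum_(0 <= j < n) (b j * beta j t w) *: e j))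
      @ \oo --> (0 : R)}.

(* u(t) + int_0^t (nu L u + Q(u)) ds = u0 + zeta(t) in the dual of V. *)
Definition integrated_NS (nu : R) (u0 : vector_field R) (zeta u : R -> vector_field R) :=
  forall t phi, 0 <= t -> spaceV a phi ->
    dotv a (u t) phi +
    \int[lebesgue_measure]_(s in `[0, t])
       (nu * stokes_pairing a (u s) phi + Q_pairing a (u s) phi) =
    dotv a u0 phi + dotv a (zeta t) phi.

Definition NS_solution (nu : R) (u0 : vector_field R) (zeta u : R -> Omega -> vector_field R) :=
  H_process u /\
  {ae P, forall w,
    [/\ C_H a (u^~ w), L2loc_V a (u^~ w), normv a (u 0 w - u0) = 0 &
        integrated_NS nu u0 (zeta^~ w) (u^~ w)]}.

Definition noise_energy (b : nat -> R) : \bar R :=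
  (\sum_(0 <= j <oo) ((b j) ^+ 2)%:E)%E.

Definition xi (u : R -> Omega -> vector_field R) (t : R) (w : Omega) : \bar R :=
  ((t^-1)%:E *
     \int[lebesgue_measure]_(s in `[0%R, t]) (sqnorm_grad a (u s w))%:E)%E.

(* [x] = B / (2 xi_t); since division is total, well-definedness of this quotient
   is expressed as unique solvability of 2 xi_t x = B. *)
Definition is_estimator (b : nat -> R) (u : R -> Omega -> vector_field R)
    (t : R) (w : Omega) (x : R) :=
  (2%:E * xi u t w * x%:E = noise_energy b)%E.

Definition full_measure (A : set Omega) := measurable A /\ P A = 1%E.

End Stochastic.

(* Main.v *)
Require Import Defs.
From HB Require Import structures.
From mathcomp Require Import all_boot all_order all_algebra.
From mathcomp Require Import all_classical all_reals all_analysis.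
From mathcomp Require Import measurable_realfun.
From mathcomp Require Import lra ring.
Set Implicit Arguments.
Unset Strict Implicit.
Unset Printing Implicit Defensive.
Import Order.TTheory GRing.Theory Num.Theory.
Import numFieldNormedType.Exports.
Local Open Scope classical_set_scope.
Local Open Scope ring_scope.

(** Were [xi_t] zero for some [t > 0], the solution would vanish on [0, t], and
    then the equation would force the noise to stay constant there; but a Brownian
    motion almost surely differs from its starting value at each of the countably
    many times [1 / (n + 1)], and these accumulate at 0.

    In detail, fix a trajectory with [xi_t = 0]. The time integral of
    [|| grad u(s) ||^2] vanishes, so every subinterval of [0, t] contains times [s]
    with [u s] in [V] and [|| grad (u s) ||] as small as desired
    ([ge0_integral0_small]). By the Poincare inequality in [V] ([poincare_V]) the
    norm of [u s] in [H] is small at these times, and by continuity in [H]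
    it is zero on all of [0, t] ([trajectory_vanishes]). Where [u s] is null and
    belongs to [V], its weak gradient is null too ([wderiv_ae0]), so the drift term
    of the equation vanishes ([drift_vanishes]). What remains of the equation tested
    against the eigenfunction [e k] says that the coordinate [b k * beta k s] of the
    noise does not depend on [s] in [0, t] ([noise_constant]). For [b k != 0], which
    happens for some [k] as [B > 0], this contradicts
    [brownian_increment_neq0], since the normal law has no atom.

    The functionals of [s] above are integrated without knowing that they are
    measurable: the integral of a nonnegative function is then a lower integral, and
    the only facts needed, monotonicity and insensitivity to null sets, survive.

    Finiteness of [xi_t], needed for [B / (2 xi_t)] to be meaningful, comes from
    [u] lying in [L^2_loc(R_+, V)] ([xi_lty]). *)

(** * Integrals of functions that need not be measurable *)

(** The integral of a nonnegative function is a supremum over the simple functions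
    below it, and this set of simple functions grows with the function. *)
Lemma ge0_le_lower_integral d (T : measurableType d) (R : realType)
    (mu : {measure set T -> \bar R}) (D : set T) (f g : T -> \bar R) :
  (forall x, D x -> 0 <= f x)%E -> (forall x, D x -> f x <= g x)%E ->
  (\int[mu]_(x in D) f x <= \int[mu]_(x in D) g x)%E.
Proof.
move=> f0 fg; have g0 x : D x -> (0 <= g x)%E.
  by move=> Dx; rewrite (le_trans (f0 _ Dx))// fg.
rewrite !ge0_integralE//; apply: ereal_sup_le => _ [h /= hf <-].
exists h => // x; rewrite (le_trans (hf x))// !patchE; case: ifPn => // /set_mem; exact: fg.
Qed.

(** The positive and negative parts lie below the measurable function that is [+oo]
    on a measurable null set and 0 elsewhere. *)
Lemma ae0_lower_integral d (T : measurableType d) (R : realType)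
    (mu : {measure set T -> \bar R}) (D : set T) (f : T -> \bar R) :
  measurable D -> {ae mu, forall x, D x -> f x = 0%E} ->
  (\int[mu]_(x in D) f x = 0)%E.
Proof.
move=> mD [N [mN N0 fN]].
have gen (g : T -> \bar R) : (forall x, 0 <= g x)%E ->
    (forall x, f x = 0 -> g x = 0)%E -> (\int[mu]_(x in D) g x = 0)%E.
  move=> g0 gf; apply/eqP; rewrite eq_le integral_ge0 ?andbT//.
  pose h : T -> \bar R := fun x => (+oo * (\1_N x)%:E)%E.
  have mh : measurable_fun D h.
    apply: measurable_funeM; apply/measurable_EFinP.
    by apply: measurable_funTS; exact: measurable_indic.
  have h0 x : (0 <= h x)%E by rewrite /h mule_ge0// lee_fin.
  apply: (@le_trans _ _ (\int[mu]_(x in D) h x)%E).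
    apply: ge0_le_lower_integral => // x Dx.
    have [Nx|Nx] := pselect (N x).
      by rewrite /h indicE mem_set// mule1 leey.
    rewrite gf//; apply: contrapT => fx; apply: Nx; apply: fN => /=.
    by apply: contra_not fx; exact.
  rewrite (@ae_eq_integral _ _ _ mu D (cst 0%E))//; first by rewrite integral0.
  exists N; split => // x /= xh; apply: contrapT => Nx; apply: xh => Dx.
  by rewrite /h indicE memNset// mule0.
rewrite integralE !gen ?sube0// => x.
- by rewrite funenegE => ->; rewrite oppe0 maxxx.
- by rewrite funeposE => ->; rewrite maxxx.
Qed.

(** Otherwise [f >= eta] on [p, q] off a null set [N], and the simple function
    [eta * 1_([p, q] \ N)], of positive integral, lies below [f]. *)
Lemma ge0_integral0_small (R : realType) (f : R -> R) (Q : R -> Prop) (t p q eta : R) :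
  (forall s, 0 <= f s) -> (\int[lebesgue_measure]_(s in `[0%R, t]) (f s)%:E = 0)%E ->
  {ae lebesgue_measure, forall s, 0 <= s -> Q s} ->
  0 <= p -> p < q -> q <= t -> 0 < eta ->
  exists s, [/\ p <= s <= q, Q s & f s < eta].
Proof.
move=> f0 if0 [N [mN N0 QN]] p0 pq qt eta0; apply: contrapT => nex.
have mD : measurable (`[p, q] `\` N : set (measurableTypeR R)) by apply: measurableD.
have : (\int[lebesgue_measure]_(s in `[0%R, t]) (eta * \1_(`[p, q] `\` N) s)%:E <= 0)%E.
  rewrite -if0; apply: ge0_le_lower_integral => s _.
    by rewrite lee_fin mulr_ge0// ltW.
  rewrite lee_fin indicE; case: (boolP (s \in _)) => [|_]; last by rewrite mulr0.
  rewrite inE => -[/= ]; rewrite in_itv/= => /andP[ps sq] nNs; rewrite mulr1 leNgt.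
  apply/negP => fs; apply: nex; exists s; split=> //; first by rewrite ps.
  apply: contrapT => nQ; apply: nNs; apply: QN => /= H; apply: nQ; apply: H.
  exact: le_trans ps.
under eq_integral do rewrite EFinM.
rewrite ge0_integralZl//;
  [|by apply/measurable_EFinP; exact: measurable_indic|by rewrite lee_fin ltW].
rewrite integral_indic//.
rewrite setIidl; last first.
  by move=> s [/=]; rewrite !in_itv/= => /andP[ps sq] _; rewrite (le_trans p0)//= (le_trans sq).
have mpq : measurable (`[p, q] : set (measurableTypeR R)) by exact: measurable_itv.
have AN0 : lebesgue_measure (`[p, q] `&` N) = 0%E.
  by apply: (subset_measure0 (B := N)) => //; exact: measurableI.
have AE : lebesgue_measure `[p, q] = (q - p)%:E by rewrite lebesgue_measure_itv/= lte_fin pq.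
have lamE : lebesgue_measure (`[p, q] `\` N) = (q - p)%:E.
  have := measureDI lebesgue_measure mpq mN.
  rewrite [X in (_ + X)%E]AN0 adde0 => <-; exact: AE.
by rewrite [X in (_ * X)%E]lamE -EFinM lee_fin leNgt mulr_gt0// subr_gt0.
Qed.

(** * Integrating continuous functions over the strip *)

(** An open set of the plane is the union of the rectangles with rational corners
    that it contains. *)
Lemma open_measurable_prod (R : realType) (U : set (R * R)) : open U ->
  measurable (U : set (measurableTypeR R * measurableTypeR R)).
Proof.
move=> oU.
pose I (q : (rat * rat) * (rat * rat)) : set (R * R) :=
  `]ratr q.1.1, ratr q.1.2[ `*` `]ratr q.2.1, ratr q.2.2[.
have -> : U = \bigcup_(q in [set q | I q `<=` U]) I q.
  apply/seteqP; split=> [x Ux|x [q /= qU] /qU//].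
  have [e /= e0 eU] := (nbhs_ballP _ _).1 (oU _ Ux).
  have lt1 (y : R) : y - e < y by rewrite ltrBlDr ltrDl.
  have lt2 (y : R) : y < y + e by rewrite ltrDl.
  have [p pi] := rat_in_itvoo (lt1 x.1).
  have [q qi] := rat_in_itvoo (lt2 x.1).
  have [r ri] := rat_in_itvoo (lt1 x.2).
  have [s si] := rat_in_itvoo (lt2 x.2).
  move: pi qi ri si; rewrite !in_itv/= => /andP[p1 p2] /andP[q1 q2].
  move=> /andP[r1 r2] /andP[s1 s2].
  exists ((p, q), (r, s)); last by rewrite /I/= !in_itv/= p2 q1 r2 s1.
  move=> y [/= ]; rewrite !in_itv/= => /andP[y1 y2] /andP[y3 y4].
  apply: eU; split => /=; rewrite /ball/= ltr_distlC.
    by rewrite (lt_trans p1 y1) (lt_trans y2 q2).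
  by rewrite (lt_trans r1 y3) (lt_trans y4 s2).
rewrite bigcup_mkcond; apply: countable_bigcupT_measurable.
  exact: countableP.
move=> q; case: ifPn => // _.
by apply: measurableX; exact: measurable_itv.
Qed.

Section area.
Context {R : realType} (a : R).
Implicit Types f g h : R * R -> R.

Local Notation lam2 := (lebesgue_measure \x lebesgue_measure)%E.

Lemma continuous_measurable_prod (f : R * R -> R) : continuous f ->
  measurable_fun [set: measurableTypeR R * measurableTypeR R] f.
Proof.
move=> /continuousP cf; apply: (measurability _ (RGenOpens.measurableE R)).
move=> _ [_ [p [q ->]] <-]; rewrite setTI; apply: open_measurable_prod.
by apply: cf; exact: interval_open.
Qed.

Lemma lam2_cell : (lam2 (cell a) < +oo)%E.
Proof.
have lt_oo (p q : R) (b c : bool) :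
    (lebesgue_measure [set` Interval (BSide b p) (BSide c q)] < +oo)%E.
  by rewrite lebesgue_measure_itv/=; case: ifPn => // _; rewrite -EFinB ltry.
rewrite product_measure1E; try exact: measurable_itv.
have ge0 (A : set (measurableTypeR R)) : (0 <= lebesgue_measure A)%E.
  exact: measure_ge0.
by apply: lte_mul_pinfty; rewrite ?ge0 ?(ge0_fin_numE (ge0 _)) ?lt_oo.
Qed.

Lemma area_cell : area a (~` cell a) = 0%E.
Proof. by rewrite /area /= /mrestr setIC setICr measure0. Qed.

Lemma continuous_bounded_cell f : continuous f ->
  [bounded f x | x in cell a].
Proof.
move=> cf.
have : compact [set f x | x in `[0, a] `*` `[-1, 1]].
  apply: continuous_compact; first exact: continuous_subspaceT.
  exact: (compact_setX (@segment_compact _ 0 a) (@segment_compact _ (-1) 1)).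
move=> /compact_bounded [M [Mreal bM]]; exists M; split=> // N MN x [x1 x2].
apply: (bM N MN); exists x => //; split => /=.
  exact: subset_itv_co_cc x1.
exact: subset_itv_oo_cc x2.
Qed.

Lemma continuous_integrable_area f : continuous f ->
  (area a).-integrable setT (EFin \o f).
Proof.
move=> cf; have mC := measurableC (measurable_cell a).
have mf : measurable_fun [set: measurableTypeR R * measurableTypeR R] (EFin \o f).
  by apply/measurable_EFinP; exact: continuous_measurable_prod.
apply/(@negligible_integrable _ _ _ (area a) _ _ _ mC measurableT mf area_cell).
rewrite setTD setCK; apply: measurable_bounded_integrable.
- exact: measurable_cell.
- by rewrite /area/= /mrestr setIid; exact: lam2_cell.
- by apply: measurable_funTS; exact: continuous_measurable_prod.
- exact: continuous_bounded_cell.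
Qed.

(** Fubini, the integrand being bounded on the relatively compact cell. *)
Lemma integral_area f : continuous f ->
  (\int[area a]_x (f x)%:E =
   \int[lebesgue_measure]_(x in `[0%R, a[)
     \int[lebesgue_measure]_(y in `](-1)%R, 1%R[) (f (x, y))%:E)%E.
Proof.
move=> cf; have mc := @measurable_cell _ a.
rewrite (@negligible_integral _ _ _ (area a) _ _ _ (measurableC mc) measurableT
  (continuous_integrable_area cf) area_cell) setTD setCK.
rewrite (@eq_measure_integral _ _ _ _ lam2); last first.
  by move=> A mA Ac; rewrite /= /mrestr setIidl.
have intc : lam2.-integrable (cell a) (EFin \o f).
  apply: measurable_bounded_integrable => //.
  - exact: lam2_cell.
  - by apply: measurable_funTS; exact: continuous_measurable_prod.
  - exact: continuous_bounded_cell.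
rewrite integral_mkcond -integral12_prod_meas1; last first.
  exact: (@integrable_mkcond _ _ _ lam2 _ _ mc).1 intc.
rewrite [RHS]integral_mkcond; apply: eq_integral => x _.
rewrite /fubini_F patchE; case: ifPn => [xa|xa].
  rewrite [RHS]integral_mkcond; apply: eq_integral => y _.
  rewrite !patchE; congr (if _ then _ else _).
  by apply/idP/idP => /set_mem; [case=> _ ?|] => *;
    apply/mem_set => //; split=> //=; exact: set_mem.
rewrite integral0_eq// => y _; rewrite patchE memNset// => -[/= xa' _].
by move/negP: xa; apply; exact/mem_set.
Qed.

Lemma continuous_Lfun2 f : continuous f -> f \in Lfun (area a) 2%:E.
Proof.
move=> cf; rewrite inE/=; apply/andP; split.
  by rewrite inE/=; exact: continuous_measurable_prod.
rewrite inE/= /finite_norm unlock /=; apply: poweR_lty.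
have cf2 : continuous (fun x => f x ^+ 2) by move=> x; apply: cvgM; exact: cf.
have /integrableP[_] := continuous_integrable_area cf2.
apply: le_lt_trans; apply: ge0_le_lower_integral => x _ /=; first by rewrite lee_fin powR_ge0.
by rewrite lee_fin powR_mulrn// normrX.
Qed.

End area.

(** * The L2 product of scalar fields *)

Section dot.
Context {R : realType} (a : R).
Implicit Types (f g h : R * R -> R).

Lemma continuous_L2 f : continuous f -> periodic1 a f -> L2 a f.
Proof. by move=> cf pf; split=> //; exact: continuous_Lfun2. Qed.

Lemma L2D f g : L2 a f -> L2 a g -> L2 a (f + g).
Proof.
move=> [pf Lf] [pg Lg]; split; first by move=> x; rewrite !fctE pf pg.
by apply: rpredD => //; rewrite lee1n.
Qed.

Lemma L2Z c f : L2 a f -> L2 a (c *: f).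
Proof.
move=> [pf Lf]; split; first by move=> x; rewrite !fctE pf.
have -> : c *: f = c \o* f by apply/funext => x; rewrite fctE [LHS]mulrC.
by apply: Lfun_scale; rewrite // ler1n.
Qed.

Lemma L20 : L2 a 0.
Proof. by apply: continuous_L2 => // x; exact: cvg_cst. Qed.

Lemma L2B f g : L2 a f -> L2 a g -> L2 a (f - g).
Proof. by move=> Lf Lg; rewrite -scaleN1r; apply: L2D => //; exact: L2Z. Qed.

Lemma L2_mul_integrable f g : L2 a f -> L2 a g ->
  (area a).-integrable setT (EFin \o (fun x => f x * g x)).
Proof. by move=> [_ Lf] [_ Lg]; apply/Lfun1_integrable; exact: Lfun2_mul_Lfun1. Qed.

Lemma dotC f g : dot a f g = dot a g f.
Proof. by rewrite /dot; congr fine; apply: eq_integral => x _; rewrite mulrC. Qed.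

Lemma dotDl f g h : L2 a f -> L2 a g -> L2 a h ->
  dot a (f + g) h = dot a f h + dot a g h.
Proof.
move=> Lf Lg Lh; rewrite /dot -RintegralD//; try exact: L2_mul_integrable.
by congr fine; apply: eq_integral => x _; rewrite fctE mulrDl.
Qed.

Lemma dotZl c f g : L2 a f -> L2 a g -> dot a (c *: f) g = c * dot a f g.
Proof.
move=> Lf Lg; rewrite /dot -RintegralZl//; try exact: L2_mul_integrable.
by congr fine; apply: eq_integral => x _; rewrite fctE mulrA.
Qed.

Lemma dotBl f g h : L2 a f -> L2 a g -> L2 a h ->
  dot a (f - g) h = dot a f h - dot a g h.
Proof.
by move=> Lf Lg Lh; rewrite -scaleN1r dotDl ?dotZl ?mulN1r//; exact: L2Z.
Qed.

Lemma dotBr f g h : L2 a f -> L2 a g -> L2 a h ->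
  dot a h (f - g) = dot a h f - dot a h g.
Proof. by move=> *; rewrite dotC dotBl// !(dotC h). Qed.

Lemma dot_ge0 f : 0 <= dot a f f.
Proof. by apply: Rintegral_ge0 => x _; rewrite -expr2 sqr_ge0. Qed.

Lemma dot_sqrB c f g : L2 a f -> L2 a g ->
  dot a (f - c *: g) (f - c *: g) =
  dot a f f - 2 * c * dot a f g + c ^+ 2 * dot a g g.
Proof.
move=> Lf Lg; have Lcg := L2Z c Lg; have LB := L2B Lf Lcg.
rewrite dotBl// dotBr// [dot a (c *: g) _]dotBr// (dotC f (c *: g)) !dotZl//.
rewrite (dotC g (c *: g)) dotZl// (dotC g f); ring.
Qed.

(** Parallelogram-type bound, which avoids square roots in later estimates. *)
Lemma dot_triangle f g : L2 a f -> L2 a g ->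
  dot a f f <= 2 * dot a (f - g) (f - g) + 2 * dot a g g.
Proof.
move=> Lf Lg; have := dot_ge0 (f - 2 *: g); rewrite dot_sqrB//.
by have := dot_sqrB 1 Lf Lg; rewrite scale1r => ->; lra.
Qed.

Lemma dot_self0_ae f : L2 a f -> dot a f f = 0 -> {ae area a, forall x, f x = 0}.
Proof.
move=> Lf f0; have intf := L2_mul_integrable Lf Lf.
have [mf _] := integrableP _ _ _ intf.
have : (\int[area a]_x `|(f x * f x)%:E| = 0)%E.
  transitivity (\int[area a]_x (f x * f x)%:E)%E.
    by apply: eq_integral => x _; rewrite gee0_abs ?lee_fin -?expr2 ?sqr_ge0.
  rewrite -[LHS]fineK; first by congr EFin.
  exact: integrable_fin_num intf.
move/(ae_eq_integral_abs _ measurableT mf).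
apply: filterS => x /(_ Logic.I) [] /eqP; rewrite mulf_eq0 orbb => /eqP.
by [].
Qed.

Lemma dot_ae0 f g : {ae area a, forall x, f x = 0} -> dot a f g = 0.
Proof.
move=> f0; rewrite /dot /Rintegral ae0_lower_integral//.
have [N [mN N0 Nf]] := f0; exists N; split => //; apply: subset_trans Nf => x /=.
by apply: contra_not => fx _; rewrite fx mul0r.
Qed.

Lemma dot_cauchy_schwarz f g : L2 a f -> L2 a g ->
  (dot a f g) ^+ 2 <= dot a f f * dot a g g.
Proof.
move=> Lf Lg; have [g0|g0] := eqVneq (dot a g g) 0.
  by rewrite dotC (dot_ae0 _ (dot_self0_ae Lg g0)) g0 expr0n mulr0.
have {g0} : 0 < dot a g g by rewrite lt_neqAle eq_sym g0 dot_ge0.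
have := dot_ge0 (f - (dot a f g / dot a g g) *: g); rewrite dot_sqrB//.
set A := dot a f f; set B := dot a f g; set C := dot a g g => + C0.
rewrite -(pmulr_rge0 _ C0).
have -> : C * (A - 2 * (B / C) * B + (B / C) ^+ 2 * C) = A * C - B ^+ 2.
  by field; rewrite gt_eqF.
by rewrite subr_ge0.
Qed.

End dot.

(** * Test functions and the Poincare inequality *)

Section poincare.
Context {R : realType} (a : R).
Implicit Types (f g h phi : R * R -> R).

Lemma smooth_continuous f : smooth f -> continuous f.
Proof. by move=> sf x; apply: differentiable_continuous; exact: (sf [::] x). Qed.

Lemma smooth_pderiv i f : smooth f -> smooth (pderiv i f).
Proof. by move=> sf w x; have := sf (rcons w i) x; rewrite foldr_rcons. Qed.

Lemma pderiv_periodic1 i f : periodic1 a f -> periodic1 a (pderiv i f).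
Proof.
move=> pf x; rewrite /pderiv /derive; 
apply: (congr1 (fun F : R -> R => lim (F @ 0^'))).
apply/funext => h /=; congr (_ *: (_ - _)); last exact: pf.
by rewrite -[RHS]pf; congr f; rewrite [LHS]surjective_pairing /= addrA.
Qed.

Lemma test_fun_pderiv i phi : test_fun a phi -> test_fun a (pderiv i phi).
Proof.
move=> [[sphi pphi] [r r1 phi0]]; split.
  by split; [exact: smooth_pderiv|exact: pderiv_periodic1].
exists ((r + 1) / 2); first lra.
move=> x rx; have {}rx : r < `|x.2| by lra.
have phix : \forall y \near x, phi y = cst 0 y.
  have : continuous (fun y : R * R => `|y.2|).
    by move=> y; apply: cvg_norm; exact: cvg_snd.
  move=> /(_ x _ (lt_nbhsr rx)) rx2.
  have {}rx2 : \forall y \near x, r < `|y.2| by exact: rx2.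
  apply: filterS rx2 => y /= ry.
  by rewrite phi0// ltW.
by rewrite /pderiv (near_eq_derive _ phix) derive_cst.
Qed.

Lemma test_fun_L2 phi : test_fun a phi -> L2 a phi.
Proof. by move=> [[sphi ?] _]; apply: continuous_L2 => //; exact: smooth_continuous. Qed.

(** The two difference quotients are the same function. *)
Lemma is_derive_section f x1 y : differentiable f (x1, y) ->
  is_derive y 1 (fun y => f (x1, y)) (pderiv ord_max f (x1, y)).
Proof.
move=> df.
have E : (fun h : R => h^-1 *: (f (h *: basis_vec ord_max + (x1, y)) - f (x1, y)))
    = (fun h : R => h^-1 *: (f (x1, h *: 1 + y) - f (x1, y))).
  apply/funext => h; congr (_ *: (f _ - _)).
  by congr (_, _) => /=; rewrite scaler0 add0r.
have : derivable f (x1, y) (basis_vec ord_max) by exact: diff_derivable.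
rewrite /derivable E => dv; split; first exact: dv.
by rewrite /derive/= -E.
Qed.

(** The integrand is the derivative of [x_2 f^2] in [x_2], and [x_2 f^2] vanishes at
    both ends of each vertical segment. *)
Lemma integral_pderiv2 f : smooth f ->
    (forall x1, f (x1, 1) = 0 /\ f (x1, -1) = 0) ->
  (\int[area a]_x (f x ^+ 2 + 2 * (x.2 * f x * pderiv ord_max f x))%:E = 0)%E.
Proof.
move=> sf f0; have cf := smooth_continuous sf.
have cdf := smooth_continuous (smooth_pderiv ord_max sf).
have cG : continuous (fun x : R * R => f x ^+ 2 + 2 * (x.2 * f x * pderiv ord_max f x)).
  move=> x; apply: cvgD; first by apply: cvgM; exact: cf.
  apply: cvgM; first exact: cvg_cst.
  apply: cvgM; last exact: cdf.
  by apply: cvgM; [exact: cvg_snd|exact: cf].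
rewrite integral_area//; apply: integral0_eq => x1 _.
have cx1 : continuous (fun y : R => (x1, y)).
  move=> y; apply: (@cvg_pair _ _ _ (nbhs y) (nbhs x1) (nbhs y)); first exact: cvg_cst.
  exact: cvg_id.
have cg : continuous (fun y : R =>
    f (x1, y) ^+ 2 + 2 * (y * f (x1, y) * pderiv ord_max f (x1, y))).
  by move=> y; apply: (@continuous_comp _ _ _ (fun y : R => (x1, y)) _ _ (cx1 y) (cG (x1, y))).
have mg := continuous_measurable_fun cg.
rewrite integral_itv_obnd_cbnd; last first.
  by apply/measurable_EFinP; exact: measurable_funTS.
rewrite integral_itv_bndo_bndc; last first.
  by apply/measurable_EFinP; exact: measurable_funTS.
pose F (y : R) := y * f (x1, y) ^+ 2.
have dF (y : R) : is_derive y 1 F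
    (f (x1, y) ^+ 2 + 2 * (y * f (x1, y) * pderiv ord_max f (x1, y))).
  have df := is_derive_section (sf [::] (x1, y)).
  have := is_deriveM (is_derive_id y (1 : R)) (is_deriveX 2 df).
  rewrite [X in is_derive _ _ X](_ : _ = F); last first.
    by apply/funext => z; rewrite /F fctE /= exprfctE.
  move=> dF; apply: is_derive_eq dF _.
  rewrite exprfctE /= expr1.
  rewrite /GRing.scale/=; ring.
have cF : continuous F.
  move=> y; apply: differentiable_continuous; apply/derivable1_diffP.
  exact: ex_derive.
rewrite /= (@continuous_FTC2 _ _ F).
- by rewrite /F !(f0 x1).1 !(f0 x1).2 expr0n/= !mulr0 subee.
- lra.
- exact: continuous_subspaceT.
- split=> [y _||]; first exact: ex_derive.
    by apply: cvg_at_right_filter; exact: cF.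
  by apply: cvg_at_left_filter; exact: cF.
- by move=> y _; rewrite derive1E; exact: derive_val.
Qed.

(** Integrating by parts against [x_2], the norm of [phi] squared is
    [-2 <phi, x_2 d_2 phi>], with [|x_2| <= 1]; expanding the square of
    [phi + 2 x_2 d_2 phi] then gives the constant 4. *)
Lemma poincare_test phi : test_fun a phi ->
  dot a phi phi <= 4 * dot a (pderiv ord_max phi) (pderiv ord_max phi).
Proof.
move=> tphi; have [[sphi pphi] [r r1 phi0]] := tphi.
set d := pderiv ord_max phi; pose k : R * R -> R := fun x => x.2 * d x.
have Lphi := test_fun_L2 tphi.
have Ld : L2 a d := test_fun_L2 (test_fun_pderiv ord_max tphi).
have cd : continuous d by exact/smooth_continuous/smooth_pderiv.
have ck : continuous k by move=> x; apply: cvgM; [exact: cvg_snd|exact: cd].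
have Lk : L2 a k.
  by apply: continuous_L2 => // x; rewrite /k /= Ld.1.
(* |x_2| <= 1 only on the cell, hence the passage to an iterated integral *)
have kd : dot a k k <= dot a d d.
  rewrite -subr_ge0 /dot -RintegralB//; try exact: L2_mul_integrable.
  rewrite /Rintegral integral_area; last first.
    by move=> x; apply: cvgB; apply: cvgM; [exact: cd|exact: cd|exact: ck|exact: ck].
  rewrite fine_ge0//; apply: integral_ge0 => x1 _; apply: integral_ge0 => y /=.
  rewrite in_itv/= /k/= => /andP[y1 y2]; rewrite lee_fin.
  have -> : d (x1, y) * d (x1, y) - y * d (x1, y) * (y * d (x1, y)) =
    (1 - y) * (1 + y) * d (x1, y) ^+ 2 by ring.
  by apply: mulr_ge0 (sqr_ge0 _); apply: mulr_ge0; lra.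
have pk : dot a phi phi + 2 * dot a phi k = 0.
  have phi1 x1 : phi (x1, 1) = 0 /\ phi (x1, -1) = 0.
    by rewrite !phi0//= ?normrN normr1 ltW.
  have Lk2 := L2Z 2 Lk.
  have -> : 2 * dot a phi k = dot a phi (2 *: k) by rewrite dotC -dotZl// dotC.
  rewrite /dot -RintegralD//; [|exact: L2_mul_integrable|exact: L2_mul_integrable].
  apply: etrans (congr1 fine (integral_pderiv2 sphi phi1)).
  rewrite /Rintegral; congr fine; apply: eq_integral => x _; congr EFin.
  rewrite !fctE /k -/d /GRing.scale/=; ring.
have := dot_ge0 a (phi - (-2) *: k); rewrite dot_sqrB//; lra.
Qed.

Lemma wderivP i f : H1 a f -> is_wderiv a i f (wderiv a i f).
Proof. by move=> [_ /(_ i)]; exact: xgetPex. Qed.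

(** The inequality passes from the approximating test functions to [f]; each of the
    two uses of [dot_triangle] costs a factor 2, whence 16. *)
Lemma poincare_H10 f : H10 a f ->
  dot a f f <= 16 * dot a (wderiv a ord_max f) (wderiv a ord_max f).
Proof.
move=> [H1f [phi [tphi phif /(_ ord_max) dphif]]].
have [Lg _] := wderivP ord_max H1f; have [Lf _] := H1f.
set g := wderiv a ord_max f in dphif Lg *.
set E1 := fun n => dot a (f - phi n) (f - phi n) in phif.
set E2 := fun n => _ in dphif.
have le n : dot a f f <= 2 * E1 n + 16 * E2 n + 16 * dot a g g.
  have Lphi := test_fun_L2 (tphi n).
  have Ldphi := test_fun_L2 (test_fun_pderiv ord_max (tphi n)).
  have := dot_triangle Lf Lphi; have := poincare_test (tphi n).
  have := dot_triangle Ldphi Lg.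
  have -> : dot a (pderiv ord_max (phi n) - g) (pderiv ord_max (phi n) - g) = E2 n.
    by rewrite /E2 /dot; congr fine; apply: eq_integral => x _; rewrite !fctE; congr EFin; ring.
  rewrite -/(E1 n); lra.
have lim : (fun n => 2 * E1 n + 16 * E2 n + 16 * dot a g g) @ \oo -->
    2 * 0 + 16 * 0 + 16 * dot a g g.
  apply: cvgD; last exact: cvg_cst.
  by apply: cvgD; apply: cvgM => //; exact: cvg_cst.
rewrite !mulr0 !add0r in lim.
exact: (ler_cvg_to (cvg_cst (dot a f f)) lim (nearW _ le)).
Qed.

(** The weak derivative [g] is the limit of the [d_i phi_n], and the [d_i phi_n] are
    themselves test functions. Since [f] is null, integration by parts makes [g]
    orthogonal to all of them, hence to their limit [g]. *)
Lemma wderiv_ae0 i f : H10 a f -> dot a f f = 0 ->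
  dot a (wderiv a i f) (wderiv a i f) = 0.
Proof.
move=> [H1f [phi [tphi _ /(_ i) dphif]]] f0.
have [Lg ibp] := wderivP i H1f; have [Lf _] := H1f.
set g := wderiv a i f in dphif Lg ibp *.
have le n : dot a g g <= dot a (g - pderiv i (phi n)) (g - pderiv i (phi n)).
  have tn := test_fun_pderiv i (tphi n).
  have gphi0 : dot a g (pderiv i (phi n)) = 0.
    apply/eqP; rewrite -oppr_eq0 -(ibp _ tn); apply/eqP.
    exact/dot_ae0/dot_self0_ae.
  have := dot_sqrB 1 Lg (test_fun_L2 tn); rewrite scale1r => ->.
  by rewrite gphi0; have := dot_ge0 a (pderiv i (phi n)); lra.
apply/eqP; rewrite eq_le dot_ge0 andbT.
exact: (ler_cvg_to (cvg_cst (dot a g g)) dphif (nearW _ le)).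
Qed.

End poincare.

(** * Vector fields *)

Section vector.
Context {R : realType} (a : R).
Implicit Types (u v w : 'I_2 -> R * R -> R).

Lemma dotv_ge0 u : 0 <= dotv a u u.
Proof. by apply: sumr_ge0 => j _; exact: dot_ge0. Qed.

Lemma normv_sqr u : normv a u ^+ 2 = dotv a u u.
Proof. by rewrite sqr_sqrtr// dotv_ge0. Qed.

Lemma sqnorm_grad_ge0 u : 0 <= sqnorm_grad a u.
Proof. by apply: sumr_ge0 => i _; apply: sumr_ge0 => j _; exact: dot_ge0. Qed.

Lemma dotv_self0 u j : dotv a u u = 0 -> dot a (u j) (u j) = 0.
Proof.
move=> /eqP; rewrite psumr_eq0; last by move=> i _; exact: dot_ge0.
by move=> /allP /(_ j (mem_index_enum j)) /eqP.
Qed.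

Lemma dotvDl u v w : (forall j, L2 a (u j)) -> (forall j, L2 a (v j)) ->
  (forall j, L2 a (w j)) -> dotv a (u + v) w = dotv a u w + dotv a v w.
Proof.
by move=> Lu Lv Lw; rewrite /dotv -big_split; apply: eq_bigr => j _; exact: dotDl.
Qed.

Lemma dotvZl (c : R) u v : (forall j, L2 a (u j)) -> (forall j, L2 a (v j)) ->
  dotv a (c *: u) v = c * dotv a u v.
Proof.
by move=> Lu Lv; rewrite /dotv big_distrr; apply: eq_bigr => j _; exact: dotZl.
Qed.

(** The Cauchy-Schwarz inequality in each component, put together by
    [(x + y)^2 <= 2 x^2 + 2 y^2]; hence the constant 4. *)
Lemma dotv_cauchy_schwarz u v : (forall j, L2 a (u j)) -> (forall j, L2 a (v j)) ->
  dotv a u v ^+ 2 <= 4 * (dotv a u u * dotv a v v).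
Proof.
move=> Lu Lv; rewrite /dotv !big_ord_recl !big_ord0 !addr0.
set i := ord0; set j := lift _ _.
have := dot_cauchy_schwarz (Lu i) (Lv i); have := dot_cauchy_schwarz (Lu j) (Lv j).
have := dot_ge0 a (u i); have := dot_ge0 a (v i).
have := dot_ge0 a (u j); have := dot_ge0 a (v j).
move: (dot a (u i) (u i)) (dot a (v i) (v i)) (dot a (u j) (u j)) (dot a (v j) (v j)).
move: (dot a (u i) (v i)) (dot a (u j) (v j)) => x y A B C D D0 C0 B0 A0 yCD xAB.
have := mulr_ge0 A0 D0; have := mulr_ge0 C0 B0; have := sqr_ge0 (x - y).
have := mulr_ge0 A0 B0; have := mulr_ge0 C0 D0.
rewrite !mulrDl !mulrDr sqrrB sqrrD; nra.
Qed.

Lemma dotv_triangle u v : (forall j, L2 a (u j)) -> (forall j, L2 a (v j)) ->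
  dotv a u u <= 2 * dotv a (v - u) (v - u) + 2 * dotv a v v.
Proof.
move=> Lu Lv; rewrite /dotv !big_distrr -big_split; apply: ler_sum => j _.
suff <- : dot a (u j - v j) (u j - v j) = dot a ((v - u) j) ((v - u) j).
  exact: dot_triangle.
by rewrite /dot; congr fine; apply: eq_integral => x _; rewrite !fctE; congr EFin; ring.
Qed.

Lemma poincare_V u : spaceV a u -> dotv a u u <= 16 * sqnorm_grad a u.
Proof.
move=> [_ H10u]; rewrite /sqnorm_grad /dot_gradv exchange_big big_distrr.
apply: ler_sum => j _; apply: le_trans (poincare_H10 (H10u j)) _.
rewrite ler_pM2l// (bigD1 ord_max)//= lerDl.
by apply: sumr_ge0 => i _; exact: dot_ge0.
Qed.

Lemma grad_ae0 u i j : spaceV a u -> dotv a u u = 0 ->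
  {ae area a, forall x, grad a u i j x = 0}.
Proof.
move=> [_ H10u] /(dotv_self0 j) u0.
apply: dot_self0_ae; first exact: (wderivP i (H10u j).1).1.
exact: wderiv_ae0.
Qed.

Lemma stokes_pairing0 u phi : spaceV a u -> dotv a u u = 0 ->
  stokes_pairing a u phi = 0.
Proof.
move=> Vu u0; apply: big1 => i _; apply: big1 => j _; exact/dot_ae0/grad_ae0.
Qed.

Lemma Q_pairing0 u phi : spaceV a u -> dotv a u u = 0 -> Q_pairing a u phi = 0.
Proof.
move=> Vu u0; apply: big1 => j _; apply: dot_ae0.
have h0 := grad_ae0 ord0 j Vu u0; have h1 := grad_ae0 (lift ord0 ord0) j Vu u0.
have aeF := ae_filter_ringOfSetsType (area a).
apply: filterS2 h0 h1 => x g0 g1.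
by rewrite /advection !big_ord_recl big_ord0 /= !fctE g0 g1 !mulr0 !addr0.
Qed.

(** The difference between the two sides is the coordinate on [e k] of the remainders
    of the series from rank [k + 1] on, and these remainders tend to 0. *)
Lemma dotv_expansion (e : nat -> 'I_2 -> R * R -> R) (c : nat -> R) z k :
  (forall j, spaceH a (e j)) -> (forall i j, dotv a (e i) (e j) = (i == j)%:R) ->
  spaceH a z ->
  (fun n => normv a (z - \sum_(0 <= j < n) c j *: e j)) @ \oo --> (0 : R) ->
  dotv a z (e k) = c k.
Proof.
move=> He oe [Lz _ _] cvz.
have Le i j : L2 a (e i j) by case: (He i).
have sumP n : (forall j, L2 a ((\sum_(0 <= i < n) c i *: e i) j)) /\
    dotv a (\sum_(0 <= i < n) c i *: e i) (e k) = (k < n)%:R * c k.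
  elim: n => [|n [LS IH]].
    rewrite big_geq//; split; first by move=> j; exact: L20.
    rewrite mul0r /dotv; apply: big1 => j _.
    by rewrite /dot /Rintegral integral0_eq// => x _; rewrite mul0r.
  rewrite big_nat_recr//=; split.
    by move=> j; apply: L2D; [exact: LS|exact: L2Z].
  rewrite dotvDl//; last by move=> j; exact: L2Z.
  rewrite IH dotvZl// oe ltnS [(k <= n)%N]leq_eqVlt eq_sym.
  by case: (eqVneq n k) => [->|_]; rewrite /= ?ltnn ?mul0r ?add0r ?mulr0 ?addr0 ?mulr1 ?mul1r.
set D := dotv a z (e k) - c k.
have le : \forall n \near \oo, D ^+ 2 <=
    4 * (normv a (z - \sum_(0 <= j < n) c j *: e j) ^+ 2 * 1).
  exists k.+1 => // n /= kn; have [LS Sk] := sumP n.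
  have := @dotv_cauchy_schwarz (z - \sum_(0 <= j < n) c j *: e j) (e k) _ (Le k).
  rewrite normv_sqr oe eqxx -scaleN1r dotvDl ?dotvZl ?Sk ?kn ?mul1r ?mulN1r//; last first.
    by move=> j; exact: L2Z.
  by apply => j; apply: L2D => //; exact: L2Z.
have lim : (fun n => 4 * (normv a (z - \sum_(0 <= j < n) c j *: e j) ^+ 2 * 1))
    @ \oo --> 4 * (0 * 0 * 1 : R).
  apply: cvgM; first exact: cvg_cst.
  by apply: cvgM; [apply: cvgM|exact: cvg_cst].
rewrite !(mulr0, mul0r) in lim.
have D0 : D ^+ 2 <= 0 by exact: (ler_cvg_to (cvg_cst (D ^+ 2)) lim le).
by apply/eqP; rewrite -subr_eq0 -sqrf_eq0 eq_le D0 sqr_ge0.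
Qed.

End vector.

(** * Trajectories with vanishing dissipation *)

Section trajectory.
Context {R : realType} (a : R).
Local Notation lam := (@lebesgue_measure R).
Context (u : R -> 'I_2 -> R * R -> R) (t : R).
Context (uV : {ae lam, forall s, 0 <= s -> spaceV a (u s)}).
Context (uC : C_H a u) (t0 : 0 < t).
Context (iu0 : (\int[lam]_(s in `[0%R, t]) (sqnorm_grad a (u s))%:E = 0)%E).

(** Near [s] there are times [s'] at which the gradient of [u s'] is small
    ([ge0_integral0_small]), hence [u s'] too by the Poincare inequality, and
    [u s'] is close to [u s]. *)
Lemma trajectory_vanishes s : 0 <= s -> s <= t -> dotv a (u s) (u s) = 0.
Proof.
move=> s0 st; have [uH cu] := uC.
apply/eqP; rewrite eq_le dotv_ge0 andbT; apply/ler_addgt0Pr => eps eps0; rewrite add0r.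
have eps4 : 0 < Num.sqrt (eps / 4) by rewrite sqrtr_gt0; lra.
have /cvgrPdist_lt /(_ _ eps4) := cu s s0.
rewrite near_withinE => -[/= delta delta0 Hd].
(* [p, q] is a nondegenerate subinterval of [0, t] inside the ball of radius delta *)
pose p := Num.max 0 (s - delta / 2); pose q := Num.min t (s + delta / 2).
have [s' [/andP[ps' s'q] Vs' fs']] : exists s', [/\ p <= s' <= q, spaceV a (u s') &
    sqnorm_grad a (u s') < eps / 64].
  apply: (ge0_integral0_small _ iu0 uV).
  - by move=> ?; exact: sqnorm_grad_ge0.
  - by rewrite le_max lexx.
  - by rewrite gt_max !lt_min t0; lra.
  - by rewrite ge_min lexx.
  - lra.
move: ps' s'q; rewrite ge_max le_min => /andP[s'0 ps'] /andP[_ s'q].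
have /Hd : ball s delta s'.
  by rewrite /ball/= ltr_distlC; lra.
move=> /(_ s'0); rewrite sub0r normrN ger0_norm ?sqrtr_ge0// => n1.
have d1 : dotv a (u s' - u s) (u s' - u s) < eps / 4.
  by rewrite -(ltr_sqrt (dotv _ _ _)) //; lra.
have Ls : forall j, L2 a (u s j) by case: (uH s s0).
have Ls' : forall j, L2 a (u s' j) by case: (uH s' s'0).
(* eps = 2 * (eps / 4) + 2 * (16 * (eps / 64)) *)
have := dotv_triangle Ls Ls'; have := poincare_V Vs'; lra.
Qed.

Lemma drift_vanishes nu s phi : 0 <= s -> s <= t ->
  \int[lam]_(r in `[0, s]) (nu * stokes_pairing a (u r) phi + Q_pairing a (u r) phi) = 0.
Proof.
move=> s0 st; rewrite /Rintegral ae0_lower_integral//.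
have aeF := ae_filter_ringOfSetsType lam.
move: uV; apply: filterS => r Vr /=; rewrite in_itv/= => /andP[r0 rs].
have ur0 := trajectory_vanishes r0 (le_trans rs st).
by rewrite stokes_pairing0 ?Q_pairing0 ?mulr0 ?addr0//; exact: Vr.
Qed.

(** In the equation tested against [e k], only the initial datum and the noise are
    left, so that [c k s = - <u0, e k>]. *)
Lemma noise_constant nu u0 zeta (e : nat -> 'I_2 -> R * R -> R) (c : nat -> R -> R) :
  integrated_NS a nu u0 zeta u ->
  (forall j, spaceV a (e j)) -> (forall i j, dotv a (e i) (e j) = (i == j)%:R) ->
  (forall s, 0 <= s -> spaceH a (zeta s)) ->
  (forall s, 0 <= s ->
    (fun n => normv a (zeta s - \sum_(0 <= j < n) c j s *: e j)) @ \oo --> (0 : R)) ->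
  forall k s, 0 <= s -> s <= t -> c k s = c k 0.
Proof.
move=> NS eV oe zH zc k.
suff H s : 0 <= s -> s <= t -> c k s = - dotv a u0 (e k).
  by move=> s s0 st; rewrite (H s)// (H 0)// ltW.
move=> s0 st; have := NS s (e k) s0 (eV k).
rewrite drift_vanishes// addr0.
have -> : dotv a (u s) (e k) = 0.
  apply: big1 => j _; apply/dot_ae0/dot_self0_ae.
    by case: (uC.1 s s0).
  exact/dotv_self0/trajectory_vanishes.
rewrite (@dotv_expansion _ a e (c^~ s) (zeta s) k)//;
  [|by move=> j; case: (eV j)|exact: zH|exact: zc].
by move=> /esym/eqP; rewrite addrC addr_eq0 => /eqP.
Qed.

End trajectory.

(** * The noise and the estimator *)

Lemma normal_prob_set1 (R : realType) (m s x : R) : normal_prob m s [set x] = 0%E.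
Proof.
have /null_content_dominatesP dom := normal_prob_dominates m s.
by apply: dom => //; exact: lebesgue_measure_set1.
Qed.

(** The increment from time 0 has a normal law, which does not charge {0}, and there
    are countably many times [1 / (n + 1)]. *)
Lemma brownian_increment_neq0 (R : realType) d (Omega : measurableType d)
    (P : probability Omega R) (W : R -> {RV P >-> R}) : brownian W ->
  {ae P, forall w, forall n, W n.+1%:R^-1 w != W 0 w}.
Proof.
move=> [_ law _ _]; apply: ae_foralln => n.
have n0 : 0 < n.+1%:R^-1 :> R by rewrite invr_gt0.
exists ((W n.+1%:R^-1 \- W 0)%R @^-1` [set 0]); split.
- by rewrite -[X in measurable X]setTI; exact: measurable_funP.
- exact: etrans (law 0 _ (lexx 0) n0 _ (measurable_set1 0)) (normal_prob_set1 _ _ _).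
- by move=> w /= /negP; rewrite negbK => /eqP ->; rewrite subrr.
Qed.

Lemma noise_energy_gt0 (R : realType) (b : nat -> R) :
  (0 < noise_energy b)%E -> exists k, b k != 0.
Proof.
move=> B0; apply: contrapT => b0; move: B0; rewrite /noise_energy eseries0 ?ltxx// => j _ _.
have [->|bj] := eqVneq (b j) 0; first by rewrite expr0n.
by exfalso; apply: b0; exists j.
Qed.

Lemma ae_full_measure (R : realType) d (Omega : measurableType d)
    (P : probability Omega R) (G : Omega -> Prop) : {ae P, forall w, G w} ->
  exists A, full_measure P A /\ forall w, A w -> G w.
Proof.
move=> [N [mN N0 GN]]; exists (~` N); split; last first.
  by move=> w nNw; apply: contrapT => nG; apply: nNw; exact: GN.
split; first exact: measurableC.
by rewrite probability_setC// N0 sube0.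
Qed.

(** The squared norm in [V] dominates the squared norm of the gradient. *)
Lemma xi_lty (R : realType) (a : R) d (Omega : measurableType d)
    (u : R -> Omega -> 'I_2 -> R * R -> R) w t : 0 < t ->
  L2loc_V a (u^~ w) -> (xi a u t w < +oo)%E.
Proof.
move=> t0 [_ _ /(_ t) ioo]; rewrite /xi lte_mul_pinfty ?lee_fin ?invr_ge0 ?(ltW t0)//.
apply: le_lt_trans ioo; apply: ge0_le_lower_integral => s _.
  by rewrite lee_fin sqnorm_grad_ge0.
by rewrite lee_fin /normV sqr_sqrtr ?lerDr ?addr_ge0 ?dotv_ge0 ?sqnorm_grad_ge0.
Qed.

Lemma estimator_unique (R : realType) (a : R) d (Omega : measurableType d)
    (b : nat -> R) (u : R -> Omega -> 'I_2 -> R * R -> R) w t :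
  (0 < noise_energy b)%E -> (noise_energy b < +oo)%E ->
  (0 < xi a u t w)%E -> (xi a u t w < +oo)%E ->
  exists! x, is_estimator a b u t w x.
Proof.
rewrite /is_estimator.
case: (noise_energy b) => [B|//|//] _ _; case: (xi a u t w) => [r|//|//].
rewrite lte_fin => r0 _; exists (B / (2 * r)); split.
  by rewrite -!EFinM; congr EFin; field; rewrite gt_eqF.
by move=> x [<-]; field; rewrite gt_eqF.
Qed.

Theorem proposition2p1 (R : realType) (a nu : R)
    (d : measure_display) (Omega : measurableType d) (P : probability Omega R)
    (b : nat -> R) (e : nat -> vector_field R) (alpha : nat -> R)
    (beta : nat -> R -> {RV P >-> R})
    (zeta u : R -> Omega -> vector_field R) (u0 : vector_field R) :
  0 < a -> 0 < nu ->
  (forall j, 0 <= b j) ->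
  (0 < noise_energy b)%E -> (noise_energy b < +oo)%E ->
  stokes_eigenbasis a e alpha ->
  (forall j, brownian (beta j)) -> independent_processes beta ->
  is_noise a b beta e zeta ->
  spaceH a u0 ->
  NS_solution a P nu u0 zeta u ->
  (exists Omega_star : set Omega, full_measure P Omega_star /\
     forall w, Omega_star w -> forall t : R, 0 < t -> (0 < xi a u t w)%E) /\
  (exists Omega_star : set Omega, full_measure P Omega_star /\
     forall w, Omega_star w -> forall t : R, 0 < t ->
       exists! x : R, is_estimator a b u t w x).
Proof.
move=> a0 nu0 b0 B0 Boo [est _ oe _] W _ [zH zc] _ [_ NS].
have [k bk] := noise_energy_gt0 B0.
have eV j : spaceV a (e j) by have [[]] := est j.
suff xiP : {ae P, forall w, forall t, 0 < t -> (0 < xi a u t w < +oo)%E}.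
  have [A [fA AP]] := ae_full_measure xiP.
  split; exists A; split=> // w Aw t t0; have /andP[x0 xoo] := AP w Aw t t0 => //.
  exact: estimator_unique.
have aeF := ae_filter_ringOfSetsType P.
apply: filterS3 zc NS (brownian_increment_neq0 (W k)) => w zcw [uC uV _ NSw] Wk t t0.
rewrite xi_lty// andbT.
have I0 : (0 <= \int[lebesgue_measure]_(s in `[0%R, t]) (sqnorm_grad a (u s w))%:E)%E.
  by apply: integral_ge0 => s _; rewrite lee_fin sqnorm_grad_ge0.
rewrite /xi mule_gt0 ?lte_fin ?invr_gt0// lt_neqAle I0 andbT eq_sym.
apply/eqP => iu0; have [uVae _ _] := uV.
have [n /= nt] : exists n, n.+1%:R^-1 < t.
  by have [n _ /(_ n (leqnn n))] := near_infty_natSinv_lt (PosNum t0); exists n.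
have n0 : 0 <= n.+1%:R^-1 :> R by rewrite invr_ge0.
have := noise_constant (c := fun j s => b j * beta j s w) uVae uC t0 iu0 NSw eV oe
  (fun s s0 => (zH s s0).1 w) zcw k n0 (ltW nt).
by move=> /(mulfI bk); apply/eqP; exact: Wk.
Qed.
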